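(* Let $\mathcal{A}\in\mathcal{H}(s_1,s_2,s_3)$ be a complete triangular arrangement in $\mathbb{P}^2$ with $0\le s_1\le s_2\le s_3$ and assume that $s_3+1\le s_1+s_2$. Let $d$ be an integer with $s_3+1\le d\le s_1+s_2$. Then $\mathrm{Der}(-\log\mathcal{A})_d\subseteq R_{d-1}\theta_E$ if and only if the matrix $M_{\mathcal{A}}^d$ has maximal rank (i.e. rank equal to its number of columns).
   Context: $\Bbbk$ is an algebraically closed field of characteristic $0$, $R=\Bbbk[x,y,z]$, $\mathbb{P}^2=\mathrm{Proj}(R)$. For a line arrangement $\mathcal{A}$ with $f_{\mathcal{A}}$ the product of linear forms defining its lines, $\mathrm{Der}(-\log\mathcal{A})=\{\theta\in \mathrm{Der}_{\Bbbk}(R): \theta(f_{\mathcal{A}})\in (f_{\mathcal{A}})\}$; $\mathrm{Der}(-\log\mathcal{A})_d$ consists of those $\theta=\theta_0\partial_x+\theta_1\partial_y+\theta_2\partial_z$ with all $\theta_i\in R_d$. $\theta_E=x\partial_x+y\partial_y+z\partial_z$. A complete triangular arrangement $\mathcal{A}\in\mathcal{H}(s_1,s_2,s_3)$ consists of the lines $x=0$, $y=0$, $z=0$ together with $s_1+s_2+s_3$ distinct lines $$x-a_iy=0\ (1\le i\le s_1),\qquad b_jx-z=0\ (1\le j\le s_2),\qquad y-c_rz=0\ (1\le r\le s_3),$$ with all $a_i,b_j,c_r\in\Bbbk\setminus\{0\}$, the $a_i$ pairwise distinct, the $b_j$ pairwise distinct, the $c_r$ pairwise distinct. Put $f_{ijr}^{s}:=b_j^{-s}-(a_ic_r)^{s}$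 (a symbol indexed by $s$, not a power). For $s_3+1\le d\le s_1+s_2$, $M_{\mathcal{A}}^d$ is the matrix with $s_1s_2s_3$ rows, indexed by triples $(i,j,r)$ with $1\le i\le s_1$, $1\le j\le s_2$, $1\le r\le s_3$, and with columns indexed by the pairs $(s,l)$ of nonnegative integers in the set described below, the entry in row $(i,j,r)$ and column $(s,l)$ being $c_r^{\,l}f_{ijr}^{s}$. Case $2d\le s_1+s_2+s_3-1$: the pairs $(s,l)$ are those with $1\le s\le d-s_3-1$, $s_1-s\le l\le d-s-1$, together with those with $0\le l\le d-s_2-1$, $s_1-l\le s\le d-l-1$ (two disjoint families). The number of columns is $(d-s_1)(2d-s_2-s_3-1)$. Case $2d\ge s_1+s_2+s_3$: the pairs $(s,l)$ are those in the four disjoint families - $1\le s\le d-s_3-1$, $s_1-s\le l\le d-s-1$; - $s_1+s_3-d\le l\le d-s_2-1$, $d-s_3\le s\le 2d-s_2-s_3-l-1$; - $0\le l\le s_1+s_3-d-1$, $s_1-l\le s\le 2d-s_2-s_3-l-1$; - $0\le l\le d-s_2-1$, $2d-s_2-s_3-l\le s\le d-l-1$. The number of columns is $\tfrac12\big(-s_1(s_1-1)-(s_2+s_3)(s_2+s_3+1-2d)\big)$. In both cases the expected (maximal) rank of $M_{\mathcal{A}}^d$ is its number of columns. *)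

(* Defs.v *)
From mathcomp Require Import all_boot all_order all_algebra.
From mathcomp Require Import mpoly zify.

Set Implicit Arguments.
Unset Strict Implicit.
Unset Printing Implicit Defensive.

Import Order.TTheory GRing.Theory Num.Theory.
Local Open Scope ring_scope.

Section Derivations.

Variable k : fieldType.
Local Notation R := {mpoly k[3]}.

Definition Der (theta : R -> R) : Prop :=
  linear theta /\ forall p q : R, theta (p * q) = theta p * q + p * theta q.

Definition vfield (c : 'I_3 -> R) (p : R) : R := \sum_(i < 3) c i * p^`M(i).

Definition Der_log (f : R) (theta : R -> R) : Prop :=
  Der theta /\ exists g : R, theta f = g * f.

(* The degree of a derivation is the degree of its coefficients, so that the
   Euler derivation has degree 1. *)
Definition Der_log_deg (f : R) (d : nat) (theta : R -> R) : Prop :=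
  Der_log f theta /\
  exists c : 'I_3 -> R, (forall i, c i \is d.-homog) /\ theta =1 vfield c.

Definition euler : R -> R := vfield (fun i => 'X_i).

Definition euler_multiple (e : nat) (theta : R -> R) : Prop :=
  exists2 g : R, g \is e.-homog & theta =1 (fun p => g * euler p).

End Derivations.

(* The variables x, y, z are 'X_0, 'X_1, 'X_2. *)
Record complete_triangular (k : fieldType) (s1 s2 s3 : nat) :=
  CompleteTriangular {
    ct_a : 'I_s1 -> k;
    ct_b : 'I_s2 -> k;
    ct_c : 'I_s3 -> k;
    ct_a_neq0 : forall i, ct_a i != 0;
    ct_b_neq0 : forall j, ct_b j != 0;
    ct_c_neq0 : forall r, ct_c r != 0;
    ct_a_inj : injective ct_a;
    ct_b_inj : injective ct_b;
    ct_c_inj : injective ct_c }.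

Section Arrangement.

Variables (k : fieldType) (s1 s2 s3 : nat) (A : complete_triangular k s1 s2 s3).
Local Notation R := {mpoly k[3]}.
Local Notation x := ('X_(0 : 'I_3) : R).
Local Notation y := ('X_(1 : 'I_3) : R).
Local Notation z := ('X_(2 : 'I_3) : R).

Definition line_forms : seq R :=
  [:: x; y; z]
    ++ [seq x - ct_a A i *: y | i <- enum 'I_s1]
    ++ [seq ct_b A j *: x - z | j <- enum 'I_s2]
    ++ [seq y - ct_c A r *: z | r <- enum 'I_s3].

Definition defining_poly : R := \prod_(l <- line_forms) l.

End Arrangement.

(* All bounds are computed in int, so no subtraction is truncated. *)
Definition is_column (s1 s2 s3 d s l : int) : bool :=
  if 2 * d <= s1 + s2 + s3 - 1 then
    [|| (1 <= s <= d - s3 - 1) && (s1 - s <= l <= d - s - 1)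
      | (0 <= l <= d - s2 - 1) && (s1 - l <= s <= d - l - 1)]
  else
    [|| (1 <= s <= d - s3 - 1) && (s1 - s <= l <= d - s - 1),
        (s1 + s3 - d <= l <= d - s2 - 1)
          && (d - s3 <= s <= 2 * d - s2 - s3 - l - 1),
        (0 <= l <= s1 + s3 - d - 1)
          && (s1 - l <= s <= 2 * d - s2 - s3 - l - 1)
      | (0 <= l <= d - s2 - 1)
          && (2 * d - s2 - s3 - l <= s <= d - l - 1)].

(* In the range of parameters considered, every column index (s, l) has
   s, l < d, hence nothing is lost by taking the pairs in 'I_d * 'I_d. *)
Lemma is_column_bounded (s1 s2 s3 d s l : nat) :
  (s1 <= s2 <= s3)%N -> (s3 + 1 <= d <= s1 + s2)%N ->
  is_column s1 s2 s3 d s l -> (s < d)%N && (l < d)%N.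
Proof. by rewrite /is_column; case: ifP => ?; lia. Qed.

Definition columns (s1 s2 s3 d : nat) : {set 'I_d * 'I_d} :=
  [set sl : 'I_d * 'I_d | is_column s1 s2 s3 d sl.1 sl.2].

Section Matrix.

Variables (k : fieldType) (s1 s2 s3 : nat) (A : complete_triangular k s1 s2 s3).

Definition fsym (s : nat) (i : 'I_s1) (j : 'I_s2) (r : 'I_s3) : k :=
  ct_b A j ^- s - (ct_a A i * ct_c A r) ^+ s.

Definition M_mx (d : nat) :
    'M[k]_(#|{: 'I_s1 * 'I_s2 * 'I_s3}|, #|columns s1 s2 s3 d|) :=
  \matrix_(u, v)
    let: (i, j, r) := enum_val u : 'I_s1 * 'I_s2 * 'I_s3 in
    let: (s, l) := enum_val v : 'I_d * 'I_d in
    ct_c A r ^+ l * fsym s i j r.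

Definition maximal_rank (d : nat) : Prop :=
  \rank (M_mx d) = #|columns s1 s2 s3 d|.

End Matrix.

(* Main.v *)
(* A derivation preserving the three coordinate axes is
   x p d_x + y q d_y + z r d_z, and it preserves the other lines if and only if
   f1 | p - q, f2 | p - r and f3 | q - r, where f1, f2, f3 are the products of
   the forms x - a_i y, b_j x - z, y - c_r z.  Being a multiple of the Euler
   derivation means p = q = r, so with e = d - 1 the first condition says that
   f1, f2, f3 have no nonzero syzygy a f1 + c f3 = b f2 in degree e.

   The columns (s, l) are the monomials x^s y^l z^(e-s-l) with s > 0 that can
   occur both in R_(e-s1) f1 and in R_(e-s2) f2 + R_(e-s3) f3, and a combination
   g of them is in the kernel of the matrix if and only if
   g(1/b_j, c_r, 1) = g(a_i c_r, c_r, 1) for all i, j, r.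

   A syzygy gives the polynomial g = a f1 = b f2 - c f3, for which both values
   vanish.  Conversely, if g is in the kernel, interpolate the common value on
   y = c_r z by a form h(y, z); then g - h vanishes on both grids of points, so
   it lies in (f1, f3) and in (f2, f3).  Without syzygies it is a multiple of
   f3; setting x = 0 shows that g itself is a multiple of f3, which is
   impossible for g <> 0 because the degree of g in z is at most e - s1 < s3. *)

Require Import Defs.
From mathcomp Require Import all_boot all_order all_algebra.
From mathcomp Require Import mpoly ring zify.
Import Order.TTheory GRing.Theory.
Local Open Scope ring_scope.

Set Implicit Arguments.
Unset Strict Implicit.
Unset Printing Implicit Defensive.

(** * Divisibility by products of primes in a domain *)

Definition divides {R : idomainType} (d p : R) : Prop := exists q, p = q * d.

Lemma divides_refl (R : idomainType) (d : R) : divides d d.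
Proof. by exists 1; rewrite mul1r. Qed.

Lemma divides0 (R : idomainType) (d : R) : divides d 0.
Proof. by exists 0; rewrite mul0r. Qed.

Lemma dividesD {R : idomainType} {d p q : R} :
  divides d p -> divides d q -> divides d (p + q).
Proof. by move=> [a ->] [b ->]; exists (a + b); rewrite mulrDl. Qed.

Lemma divides_mull {R : idomainType} {d p : R} (q : R) :
  divides d p -> divides d (q * p).
Proof. by move=> [a ->]; exists (q * a); rewrite mulrA. Qed.

Lemma divides_mulr {R : idomainType} {d p : R} (q : R) :
  divides d p -> divides d (p * q).
Proof. by rewrite mulrC; apply: divides_mull. Qed.

(* [sigma] embeds R / (l) into the domain R, so [l] is prime. *)
Definition retraction_mod {R : idomainType} (l : R) (sigma : {rmorphism R -> R}) :=
  sigma l = 0 /\ forall p, divides l (p - sigma p).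

Lemma retraction_modP {R : idomainType} {l : R} {sigma : {rmorphism R -> R}} p :
  retraction_mod l sigma -> divides l p <-> sigma p = 0.
Proof.
case=> sl0 sP; split=> [[q ->]|sp0]; first by rewrite rmorphM sl0 mulr0.
by have := sP p; rewrite sp0 subr0.
Qed.

(** Write [p = q * l i]. For every other index [j], [sigma j (l i)] is nonzero in a domain, so
    [sigma j] kills [q] and induction applies to [q]. *)
Lemma prod_divides (R : idomainType) (I : eqType) (s : seq I) (l : I -> R)
    (sigma : I -> {rmorphism R -> R}) (p : R) :
  uniq s -> (forall i, retraction_mod (l i) (sigma i)) ->
  (forall i j, i != j -> sigma i (l j) != 0) ->
  (forall i, i \in s -> sigma i p = 0) -> divides (\prod_(i <- s) l i) p.
Proof.
move=> us lP ll; elim: s us p => [|i s IH] /= us p sp0.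
  by rewrite big_nil; exists p; rewrite mulr1.
case/andP: us => is_ us; rewrite big_cons.
have /(retraction_modP _ (lP i)) [q Dp] := sp0 i (mem_head _ _).
case: (IH us q) => [j js|r Dq]; last by exists r; rewrite Dp Dq mulrAC mulrA.
have : sigma j p = 0 by apply: sp0; rewrite inE js orbT.
move/eqP; rewrite Dp rmorphM mulf_eq0 (negPf (ll _ _ _)) ?orbF => [/eqP //|].
by apply: contraNneq is_ => <-.
Qed.

(* Induction on [s]: [sigma i p] is a multiple of the product of the [m r], and
   the quotient of [p - sigma i p] by [l i] vanishes on the remaining grid. *)
Lemma grid_ideal (R : idomainType) (I J : eqType) (s : seq I) (t : seq J)
    (l : I -> R) (m : J -> R) (sigma : I -> {rmorphism R -> R})
    (tau : J -> {rmorphism R -> R}) (p : R) :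
  uniq s -> uniq t ->
  (forall i, retraction_mod (l i) (sigma i)) ->
  (forall r, retraction_mod (m r) (tau r)) ->
  (forall i r, sigma i (m r) = m r) ->
  (forall i j r, i != j -> tau r (sigma i (l j)) != 0) ->
  (forall r r', r != r' -> tau r (m r') != 0) ->
  (forall i r, i \in s -> r \in t -> tau r (sigma i p) = 0) ->
  exists a c, p = a * \prod_(i <- s) l i + c * \prod_(r <- t) m r.
Proof.
move=> us ut lP mP sm ll mm.
elim: s us p => [|i s IH] /= us p sp0.
  by exists p, 0; rewrite big_nil mulr1 mul0r addr0.
case/andP: us => is_ us; rewrite big_cons.
have [q Dq] := (lP i).2 p.
have [c Dc] : divides (\prod_(r <- t) m r) (sigma i p).
  by apply: (prod_divides ut mP mm) => r rt; apply: sp0; rewrite ?mem_head.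
have {Dq}Dp : p = c * \prod_(r <- t) m r + q * l i by rewrite -Dc -Dq addrC subrK.
case: (IH us q) => [j r js rt|a [c' Dq]]; last first.
  by exists a, (c + c' * l i); rewrite Dp Dq; ring.
have gT0 : tau r (sigma j (\prod_(r' <- t) m r')) = 0.
  rewrite !rmorph_prod (big_rem r) //= sm (mP r).1 mul0r //.
have := sp0 j r; rewrite inE js orbT => /(_ isT rt) /eqP.
rewrite Dp !rmorphD !rmorphM /= gT0 mulr0 add0r.
rewrite mulf_eq0 (negPf (ll _ _ _ _)) ?orbF => [/eqP //|].
by apply: contraNneq is_ => <-.
Qed.

(** Modulo [l i], the Leibniz rule leaves [theta (l i)] times the product of the other factors,
    which [sigma i] does not kill. Conversely, the property of dividing its own image under [theta]
    is stable under products. *)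
Lemma leibniz_prod_divides (R : idomainType) (I : finType) (l : I -> R)
    (sigma : I -> {rmorphism R -> R}) (theta : R -> R) :
  (forall p q, theta (p * q) = theta p * q + p * theta q) ->
  (forall i, retraction_mod (l i) (sigma i)) ->
  (forall i j, i != j -> sigma i (l j) != 0) ->
  divides (\prod_i l i) (theta (\prod_i l i)) <->
  (forall i, divides (l i) (theta (l i))).
Proof.
move=> thetaM lP ll; split=> [dv i|dv].
  have {dv} : divides (l i) (theta (\prod_i l i)).
    case: dv => q ->; rewrite (bigD1 i) //= mulrCA.
    exact: divides_mulr (divides_refl _).
  rewrite (bigD1 i) //= thetaM => dv.
  apply/(retraction_modP _ (lP i)); move/(retraction_modP _ (lP i)): dv => /eqP.
  rewrite rmorphD !rmorphM /= (lP i).1 mul0r addr0 mulf_eq0 => /orP[/eqP //|].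
  rewrite rmorph_prod prodf_seq_eq0 => /hasP[j _ /andP[ji]].
  by rewrite (negPf (ll _ _ _)) // eq_sym.
have theta1 : theta 1 = 0.
  by have := thetaM 1 1; rewrite !mul1r mulr1 => /eqP; rewrite -subr_eq subrr eq_sym => /eqP.
elim/big_ind: _ => [|p q [a Dp] [b Dq]|//]; first by rewrite theta1; apply: divides0.
by exists (a + b); rewrite thetaM Dp Dq; ring.
Qed.

(** * Substitutions in the polynomial ring in three variables *)

Section Polynomials.

Variable k : fieldType.
Local Notation R := {mpoly k[3]}.
Local Notation x := ('X_(0 : 'I_3) : R).
Local Notation y := ('X_(1 : 'I_3) : R).
Local Notation z := ('X_(2 : 'I_3) : R).

Definition subst3 (p q r : R) : {rmorphism R -> R} := comp_mpoly [tuple p; q; r].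

Lemma subst3x p q r : subst3 p q r x = p.
Proof. by rewrite /= comp_mpolyXU. Qed.

Lemma subst3y p q r : subst3 p q r y = q.
Proof. by rewrite /= comp_mpolyXU. Qed.

Lemma subst3z p q r : subst3 p q r z = r.
Proof. by rewrite /= comp_mpolyXU. Qed.

Lemma subst3Z p q r (c : k) f : subst3 p q r (c *: f) = c *: subst3 p q r f.
Proof. exact: comp_mpolyZ. Qed.

Definition subst3E := (subst3x, subst3y, subst3z, subst3Z, rmorphD, rmorphB).

Lemma ord3P (P : 'I_3 -> Prop) : P 0 -> P 1 -> P 2 -> forall i, P i.
Proof.
move=> P0 P1 P2 [[|[|[|//]]] lti].
- by rewrite (_ : Ordinal lti = 0) //; apply: val_inj.
- by rewrite (_ : Ordinal lti = 1) //; apply: val_inj.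
- by rewrite (_ : Ordinal lti = 2) //; apply: val_inj.
Qed.

(** Congruence modulo [l] between a polynomial and its image is stable under linear combinations and
    products, so it is enough to have it on the variables. *)
Lemma subst3_congr (l p q r f : R) :
  divides l (x - p) -> divides l (y - q) -> divides l (z - r) ->
  divides l (f - subst3 p q r f).
Proof.
move=> lp lq lr.
have congrX i : divides l ('X_i - subst3 p q r 'X_i).
  by elim/ord3P: i; rewrite ?subst3x ?subst3y ?subst3z.
move: (subst3 p q r) (@subst3Z p q r) congrX => s sZ congrX {lp lq lr}.
have congrM (g h : R) : divides l (g - s g) -> divides l (h - s h) ->
  divides l (g * h - s (g * h)).
  move=> lg lh; rewrite rmorphM.
  have -> : g * h - s g * s h = g * (h - s h) + (g - s g) * s h by ring.
  by apply: dividesD; [apply: divides_mull|apply: divides_mulr].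
have congr1 : divides l (1 - s 1) by rewrite rmorph1 subrr; apply: divides0.
elim/mpolyind: f => [|c m f _ _ IH]; first by rewrite rmorph0 subr0; apply: divides0.
rewrite rmorphD opprD addrACA; apply: dividesD => //.
rewrite sZ -scalerBr -mul_mpolyC; apply: divides_mull.
rewrite mpolyXE_id; elim/big_ind: _ => // i _; elim: (m i) => [//|e IHe].
by rewrite exprS; apply: congrM.
Qed.

(** * Linear forms and elimination of one variable *)

Definition lform (u : k * k * k) : R := u.1.1 *: x + u.1.2 *: y + u.2 *: z.

Lemma lform_eq0 u : lform u = 0 -> u = 0.
Proof.
move=> u0; case: u u0 => [[a b] c] u0.
have cf i : (lform (a, b, c))@_U_(i) = 0 by rewrite u0 mcoeff0.
move: (cf 0) (cf 1) (cf 2); rewrite /lform !mcoeffD !mcoeffZ !mcoeffXU /=.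
by rewrite !(mulr0, mulr1, addr0, add0r) => -> -> ->.
Qed.

(** Solves [lform u = 0] for the first variable with a nonzero coefficient; the last branch serves
    the multiples of [z]. *)
Definition elim_lform (u : k * k * k) : {rmorphism R -> R} :=
  let: (a, b, c) := u in
  if a != 0 then subst3 (lform (0, - b / a, - c / a)) y z
  else if b != 0 then subst3 x (lform (0, 0, - c / b)) z
  else subst3 x y 0.

Lemma subst3_lform p q r u :
  subst3 p q r (lform u) = u.1.1 *: p + u.1.2 *: q + u.2 *: r.
Proof. by rewrite /lform !subst3E. Qed.

Lemma elim_lformP u : u != 0 -> retraction_mod (lform u) (elim_lform u).
Proof.
case: u => [[a b] c] u0; rewrite /elim_lform.
have [a0|a0] := eqVneq a 0 => /=; last first.
  have Eb : b = - (a * (- b / a)) by field.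
  have Ec : c = - (a * (- c / a)) by field.
  (* Once the ratios are named [b'] and [c'], the coefficients are multiples of [a] and no division
     is left for [ring]. *)
  move: (- b / a) (- c / a) Eb Ec => b' c' -> ->; split=> [|f].
    by rewrite subst3_lform /lform /= -!mul_mpolyC; ring.
  apply: subst3_congr; rewrite ?subrr; try exact: divides0.
  exists a^-1%:MP; rewrite mul_mpolyC /lform /= scale0r add0r !scalerDr !scalerA.
  by rewrite !mulrN mulKf // mulKf // mulVf // scale1r !scaleNr opprD addrA.
have [b0|b0] := eqVneq b 0 => /=; last first.
  have Ec : c = - (b * (- c / b)) by field.
  move: (- c / b) Ec => c' ->; split=> [|f].
    by rewrite subst3_lform /lform /= a0 -!mul_mpolyC; ring.
  apply: subst3_congr; rewrite ?subrr; try exact: divides0.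
  exists b^-1%:MP; rewrite mul_mpolyC /lform /= a0 !scale0r !add0r.
  by rewrite scalerDr !scalerA mulrN mulKf // mulVf // scale1r scaleNr.
have c0 : c != 0 by apply: contraNneq u0 => ->; rewrite a0 b0.
split=> [|f]; first by rewrite subst3_lform /= a0 b0 !scale0r scaler0 !add0r.
apply: subst3_congr; rewrite ?subrr ?subr0; try exact: divides0.
exists c^-1%:MP; rewrite /lform a0 b0 !scale0r !add0r /= mul_mpolyC scalerA.
by rewrite mulVf // scale1r.
Qed.

(** The conclusions are the 2 by 2 minors of [u] and [v], so that distinctness of two lines can be
    checked on coefficients. *)
Lemma elim_lform_proportional u v : elim_lform u (lform v) = 0 ->
  [/\ u.1.1 * v.1.2 = u.1.2 * v.1.1, u.1.1 * v.2 = u.2 * v.1.1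
    & u.1.2 * v.2 = u.2 * v.1.2].
Proof.
move: u v => [[a b] c] [[a' b'] c']; rewrite /elim_lform.
have [a0|a0] := eqVneq a 0 => /=; last first.
  rewrite subst3_lform /= => e.
  have : lform (0, b' - a' * b / a, c' - a' * c / a) = 0.
    rewrite -[RHS]e /lform /= -!mul_mpolyC; ring.
  move/lform_eq0 => [/eqP e1 /eqP e2]; move: e1 e2.
  rewrite !subr_eq0 => /eqP -> /eqP ->.
  by split; field.
have [b0|b0] := eqVneq b 0 => /=; last first.
  rewrite subst3_lform /= => e.
  have : lform (a', 0, c' - b' * c / b) = 0.
    rewrite -[RHS]e /lform /= -!mul_mpolyC; ring.
  move/lform_eq0 => [-> /eqP]; rewrite subr_eq0 => /eqP ->.
  by rewrite a0 !mul0r !mulr0; split=> //; field.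
rewrite subst3_lform /= scaler0 => e.
have : lform (a', b', 0) = 0 by rewrite /lform scale0r.
by case/lform_eq0 => -> ->; rewrite a0 b0 !mul0r !mulr0.
Qed.

(** * Homogeneous components and cofactors *)

Lemma pihomogMr (p q : R) (a b : nat) :
  q \is b.-homog -> pihomog mdeg (a + b) (p * q) = pihomog mdeg a p * q.
Proof.
(* By additivity each homogeneous component of [p] is treated separately; after multiplication by
   [q] only the one of degree [a] reaches degree [a + b]. *)
move=> hq; have [w ->] : exists w, p = \sum_(i < w) pihomog mdeg i p.
  by exists (msize p); apply: (pihomog_partitionE (mf := mdeg)).
rewrite mulr_suml !(raddf_sum (pihomog mdeg _)) mulr_suml /=.
apply: eq_bigr => i _; have hi := pihomogP mdeg i p.
have [->|ia] := eqVneq (i : nat) a.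
  by rewrite pihomog_id pihomog_dE // dhomogM // pihomogP.
rewrite (pihomog_ne0 ia hi) mul0r.
by rewrite (pihomog_ne0 _ (dhomogM hi hq)) // eqn_add2r.
Qed.

(** Multiplication by [q] is injective, and by [pihomogMr] both [p] and its component of degree
    [d - b] have the same product with [q]. *)
Lemma dhomog_cofactor (p q : R) (d b : nat) :
  (b <= d)%N -> q != 0 -> q \is b.-homog -> p * q \is d.-homog ->
  p \is (d - b).-homog.
Proof.
move=> bd q0 hq hpq; rewrite homog_piE -(inj_eq (mulIf q0)).
by rewrite -(pihomogMr _ _ hq) subnK // pihomog_dE.
Qed.

Lemma dhomog_prod_linear (I : finType) (l : I -> R) :
  (forall i, l i \is 1.-homog) -> \prod_i l i \is #|I|.-homog.
Proof.
move=> hl; rewrite -sum1_card; elim/big_rec2: _ => [|i n p _ hp].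
  exact: dhomog1.
exact: dhomogM.
Qed.

Lemma dhomogXi i : ('X_i : R) \is 1.-homog.
Proof. by rewrite dhomogX /= mdeg1. Qed.

(** * Action of vector fields on variables and linear forms *)

Lemma vfield_linear (c : 'I_3 -> R) : linear (vfield c).
Proof.
move=> a p q; rewrite /vfield scaler_sumr -big_split; apply: eq_bigr => i _ /=.
by rewrite mderivD mderivZ mulrDr scalerAr.
Qed.

Lemma vfieldM (c : 'I_3 -> R) p q :
  vfield c (p * q) = vfield c p * q + p * vfield c q.
Proof.
rewrite /vfield mulr_suml mulr_sumr -big_split; apply: eq_bigr => i _ /=.
by rewrite mderivM; ring.
Qed.

Lemma vfieldX (c : 'I_3 -> R) i : vfield c 'X_i = c i.
Proof.
rewrite /vfield (bigD1 i) //= mderivX mnm1E eqxx scale1r.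
have -> : (U_(i) - U_(i))%MM = 0%MM by apply/mnmP => j; rewrite mnmBE subnn mnm0E.
rewrite mpolyX0 mulr1 big1 ?addr0 // => j ji.
by rewrite mderivX mnm1E eq_sym (negPf ji) scale0r mulr0.
Qed.

Lemma vfield_lform (c : 'I_3 -> R) u :
  vfield c (lform u) = u.1.1 *: c 0 + u.1.2 *: c 1 + u.2 *: c 2.
Proof.
have D p q : vfield c (p + q) = vfield c p + vfield c q.
  by have := vfield_linear c 1 p q; rewrite !scale1r.
have Z a p : vfield c (a *: p) = a *: vfield c p.
  have := vfield_linear c a p 0; rewrite !addr0 => ->.
  by have := vfield_linear c (-1) 0 0; rewrite addr0 !scaleN1r addNr oppr0 => ->; rewrite addr0.
by rewrite /lform !D !Z !vfieldX.
Qed.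

(** * Degree in one variable; the bound 0 expresses independence of that variable *)

Definition deg_in_le (n : 'I_3) (D : nat) (f : R) : Prop :=
  forall m, m \in msupp f -> (m n <= D)%N.

Lemma deg_in_leM n D E p q :
  deg_in_le n D p -> deg_in_le n E q -> deg_in_le n (D + E) (p * q).
Proof.
move=> hp hq m /msuppM_le /allpairsP[[m1 m2] /= [m1p m2q ->]].
by rewrite mnmDE leq_add ?hp ?hq.
Qed.

Lemma deg_in_leB n D p q :
  deg_in_le n D p -> deg_in_le n D q -> deg_in_le n D (p - q).
Proof.
by move=> hp hq m /msuppB_le; rewrite mem_cat => /orP[/hp|/hq].
Qed.

Lemma deg_in_leZ n D (c : k) p : deg_in_le n D p -> deg_in_le n D (c *: p).
Proof. by move=> hp m /msuppZ_le/hp. Qed.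

Lemma deg_in_leX n i : i != n -> deg_in_le n 0 'X_i.
Proof. by move=> ni m; rewrite msuppX inE => /eqP ->; rewrite mnm1E (negPf ni). Qed.

Lemma deg_in_le_prod n (I : finType) (l : I -> R) :
  (forall i, deg_in_le n 0 (l i)) -> deg_in_le n 0 (\prod_i l i).
Proof.
move=> hl; elim/big_ind: _ => // [m|p q hp hq].
  by rewrite msupp1 inE => /eqP ->; rewrite mnm0E.
by rewrite -[0%N]/(0 + 0)%N; apply: deg_in_leM.
Qed.

Lemma deg_in_le_homog n d p : p \is d.-homog -> deg_in_le n d p.
Proof.
move=> hp m mp; rewrite -(dhomog_mf hp mp) /= mdegE.
by rewrite (bigD1 n) //= leq_addr.
Qed.

Lemma subst3_indep_x p f : deg_in_le 0 0 f -> subst3 p y z f = f.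
Proof.
move=> hf; rewrite /= comp_mpolyEX [RHS]mpolyE; apply: eq_big_seq => m mf.
congr (_ *: _); rewrite comp_mpolyX [RHS]mpolyXE_id; apply: eq_bigr => i _.
have := hf m mf; rewrite leqn0 => /eqP m0.
by elim/ord3P: i; rewrite (tnth_nth 0) //= m0 !expr0.
Qed.

(* If the product has degree < D in z then q has degree < D - 1: the coefficient
   of the product at [z m] is [- c q_m] plus the coefficient of q at [z m / y],
   which is handled by induction on the exponent of y. *)
Lemma cofactor_form3_low (c : k) (D : nat) q : c != 0 ->
  (forall m : 'X_{1..3}, (D <= m 2%R)%N -> (q * (y - c *: z))@_m = 0) ->
  forall m : 'X_{1..3}, (D.-1 <= m 2%R)%N -> q@_m = 0.
Proof.
move=> c0 hq m; have [n] := ubnP (m 1%R).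
elim: n m => // n IH m; rewrite ltnS => mn Dm.
have: (q * (y - c *: z))@_(U_(2) + m) = 0.
  by apply: hq; rewrite mnmDE mnm1E eqxx; lia.
rewrite mulrBr -scalerAr mcoeffB mcoeffZ mcoeffMX.
suff -> : (q * y)@_(U_(2) + m) = 0.
  by move/eqP; rewrite sub0r oppr_eq0 mulf_eq0 (negPf c0) => /eqP.
have [m10|m1] := posnP (m 1%R).
  apply: memN_msupp_eq0; rewrite (perm_mem (msuppMX _ _)).
  apply/negP => /mapP[m' _ /(congr1 (fun m'' : 'X_{1..3} => m'' 1%R))].
  by rewrite !mnmDE !mnm1E m10.
have -> : (U_(2) + m = U_(1) + (U_(2) + m - U_(1)))%MM.
  apply/mnmP => i; rewrite !mnmDE mnmBE mnmDE.
  by elim/ord3P: i; rewrite !mnm1E /=; lia.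
rewrite mcoeffMX; apply: IH; rewrite mnmBE mnmDE !mnm1E /=; lia.
Qed.

(** Each factor removed lowers the bound by one. For [D = #|I|] the conclusion is [q = 0]: a nonzero
    multiple of the product has degree at least [#|I|] in [z]. *)
Lemma cofactor_prod_form3_low (I : finType) (c : I -> k) (D : nat) q :
  (forall r, c r != 0) ->
  (forall m : 'X_{1..3}, (D <= m 2%R)%N -> (q * \prod_r (y - c r *: z))@_m = 0) ->
  forall m : 'X_{1..3}, (D - #|I| <= m 2%R)%N -> q@_m = 0.
Proof.
move=> c0; rewrite cardE -big_enum.
elim: (enum I) q => [|r s IH] q /=.
  by rewrite big_nil mulr1 subn0.
rewrite big_cons mulrA subnS => /IH; exact: cofactor_form3_low.
Qed.

(** * Values at the points (u : c : 1) *)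

Definition pnt (u c : k) (n : 'I_3) : k :=
  if n == 0 then u else if n == 1 then c else 1.

(** By homogeneity all powers of [z] combine into [z ^+ e]. Vanishing at a point thus becomes
    vanishing under a substitution, the form in which [grid_ideal] needs it. *)
Lemma subst3_line e u c g : g \is e.-homog ->
  subst3 (u *: z) (c *: z) z g = g.@[pnt u c] *: z ^+ e.
Proof.
move=> hg; rewrite /= comp_mpolyE mevalE scaler_suml; apply: eq_big_seq => m mg.
rewrite -scalerA; congr (_ *: _); have := dhomog_mf hg mg; rewrite /= mdegE.
rewrite !big_ord_recl !big_ord0 => <-; rewrite !(tnth_nth 0) /= /pnt /=.
by rewrite expr1n !exprZn !mulr1 addn0 !exprD -!mul_mpolyC mpolyCM; ring.
Qed.

(** An algebra endomorphism is determined by the images of the variables; this serves to compute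
    composites of eliminations. *)
Lemma subst3_ext (s : {rmorphism R -> R}) f :
  (forall c p, s (c *: p) = c *: s p) -> s f = subst3 (s x) (s y) (s z) f.
Proof.
move=> sZ; rewrite [f in LHS]mpolyE /= comp_mpolyE rmorph_sum.
apply: eq_bigr => m _; rewrite sZ mpolyXE_id rmorph_prod; congr (_ *: _).
rewrite !big_ord_recl !big_ord0 !(tnth_nth 0) /= !rmorphXn /=.
by congr (s 'X_ _ ^+ _ * (s 'X_ _ ^+ _ * (s 'X_ _ ^+ _ * _))); apply: val_inj.
Qed.

(** * Monomials of degree [e], indexed by their exponents in [x] and [y] *)

Definition mon (e s l : nat) : 'X_{1..3} :=
  [multinom nth 0%N [:: s; l; e - (s + l)]%N i | i < 3].

Lemma monE e s l : (mon e s l 0%R = s) * (mon e s l 1%R = l)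
  * (mon e s l 2%R = e - (s + l))%N.
Proof. by rewrite /mon !mnmE. Qed.

Lemma mdeg3 (m : 'X_{1..3}) :
  mdeg m = (m 0%R + m 1%R + m 2%R)%N.
Proof.
rewrite mdegE !big_ord_recl big_ord0 addn0 addnA.
by congr (m _ + m _ + m _)%N; apply: val_inj.
Qed.

(** The bound [s + l <= e] excludes truncation in the exponent of [z], so that the monomial really
    has degree [e]. *)
Lemma mon_eq e s l m : (s + l <= e)%N ->
  (mon e s l == m) = [&& mdeg m == e, m 0%R == s & m 1%R == l].
Proof.
move=> sle; apply/eqP/idP => [<-|/and3P[/eqP dm /eqP m0 /eqP m1]].
  by rewrite mdeg3 !monE !eqxx !andbT; lia.
move: dm; rewrite mdeg3 => dm; apply/mnmP => i.
by elim/ord3P: i; rewrite monE; lia.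
Qed.

Lemma homog_monE e (g : R) : g \is e.-homog ->
  g = \sum_(sl : 'I_e.+1 * 'I_e.+1 | (sl.1 + sl.2 <= e)%N)
        g@_(mon e sl.1 sl.2) *: 'X_[mon e sl.1 sl.2].
Proof.
move=> hg; apply/mpolyP => m; rewrite raddf_sum /=.
have [dm|dm] := eqVneq (mdeg m) e; last first.
  rewrite (dhomog_nemf_coeff hg) // big1 // => -[s l] /= sl.
  by rewrite mcoeffZ mcoeffX mon_eq // (negPf dm) mulr0.
have := dm; rewrite mdeg3 => dm3.
have ms : (m 0%R < e.+1)%N by lia.
have ml : (m 1%R < e.+1)%N by lia.
have Dm : mon e (m 0%R) (m 1%R) = m.
  by apply/eqP; rewrite mon_eq ?dm ?eqxx //; lia.
rewrite (bigD1 (Ordinal ms, Ordinal ml)) /=; last by lia.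
rewrite Dm mcoeffZ mcoeffX eqxx mulr1 big1 ?addr0 // => -[s l] /= /andP[sl ne].
rewrite mcoeffZ mcoeffX mon_eq //; case: and3P => [[_ /eqP m0 /eqP m1]|_].
  by case/eqP: ne; congr (_, _); apply: val_inj.
by rewrite mulr0.
Qed.

Lemma mon_homog e s l : (s + l <= e)%N -> ('X_[mon e s l] : R) \is e.-homog.
Proof. by move=> sl; rewrite dhomogX /= mdeg3 !monE; lia. Qed.

Lemma meval_mon e s l u c : ('X_[mon e s l] : R).@[pnt u c] = u ^+ s * c ^+ l.
Proof.
by rewrite mevalX !big_ord_recl big_ord0 /pnt /= !mnmE /= expr1n !mulr1.
Qed.

Lemma meval_homog e (g : R) u c : g \is e.-homog ->
  g.@[pnt u c] = \sum_(sl : 'I_e.+1 * 'I_e.+1 | (sl.1 + sl.2 <= e)%N)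
        g@_(mon e sl.1 sl.2) * (u ^+ sl.1 * c ^+ sl.2).
Proof.
move=> hg; rewrite {1}(homog_monE hg) raddf_sum /=.
by apply: eq_bigr => sl _; rewrite mevalZ meval_mon.
Qed.

(** Homogeneous Lagrange interpolation in [y] and [z] alone, hence with values independent of the
    coordinate [u]. *)
Lemma interpolation (s e : nat) (c : 'I_s -> k) (v : 'I_s -> k) :
  injective c -> (s <= e)%N ->
  exists h : R, [/\ h \is e.-homog, deg_in_le 0 0 h
    & forall r u, h.@[pnt u (c r)] = v r].
Proof.
move=> ci se.
have [L LP] : exists L : 'I_s -> R, forall r, [/\ L r \is e.-homog,
    deg_in_le 0 0 (L r) & forall r' u, (L r).@[pnt u (c r')] = (r == r')%:R].
  (* The factor omitted in Lagrange's formula is replaced by [z], which takes the value 1 at the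
     points considered and makes the degree exactly [s]. *)
  pose N r : R := \prod_(r' < s) (if r' == r then z else (c r - c r')^-1 *: (y - c r' *: z)).
  have hN r : N r \is s.-homog.
    rewrite -[s]card_ord; apply: dhomog_prod_linear => r'; case: eqP => _.
      exact: dhomogXi.
    by rewrite rpredZ // rpredB ?rpredZ ?dhomogXi.
  (* The power of [z] raises the degree to [e] without changing these values. *)
  exists (fun r => N r * z ^+ (e - s)) => r; split.
  - by have := dhomogM (hN r) (dhomogMn (e - s) (dhomogXi 2)); rewrite mul1n subnKC.
  - rewrite -[0%N]/(0 + 0)%N; apply: deg_in_leM; last first.
      by rewrite -[(e - s)%N]card_ord -prodr_const; apply: deg_in_le_prod => i; apply: deg_in_leX.
    apply: deg_in_le_prod => r'; case: eqP => _; first exact: deg_in_leX.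
    by apply/deg_in_leZ/deg_in_leB; [apply: deg_in_leX|apply/deg_in_leZ/deg_in_leX].
  - move=> r' u; rewrite mevalM rmorphXn /= mevalXU /pnt /= expr1n mulr1 rmorph_prod /=.
    have [<-|rr] := eqVneq r r'.
      rewrite big1 // => i _; case: eqP => [_|/eqP ir]; first by rewrite mevalXU.
      rewrite mevalZ mevalB mevalZ !mevalXU /= mulr1 mulVf //.
      by rewrite subr_eq0 (inj_eq ci) eq_sym.
    rewrite (bigD1 r') //= eq_sym (negPf rr) mevalZ mevalB mevalZ !mevalXU /=.
    by rewrite mulr1 subrr mulr0 mul0r.
exists (\sum_r v r *: L r); split.
- by apply: rpred_sum => r _; rewrite rpredZ //; case: (LP r).
- elim/big_ind: _ => [m|p q hp hq|r _]; first by rewrite msupp0.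
    by move=> m /msuppD_le; rewrite mem_cat => /orP[/hp|/hq].
  by apply: deg_in_leZ; case: (LP r).
- move=> r u; rewrite raddf_sum (bigD1 r) //= mevalZ.
  have [_ _ ->] := LP r; rewrite eqxx mulr1 big1 ?addr0 // => r' r'r.
  by rewrite mevalZ; have [_ _ ->] := LP r'; rewrite (negPf r'r) mulr0.
Qed.

End Polynomials.

(** * The lines of the arrangement as pairwise distinct primes *)

Section Lines.

Variables (k : fieldType) (s1 s2 s3 : nat) (A : complete_triangular k s1 s2 s3).
Local Notation R := {mpoly k[3]}.
Local Notation line_index := ('I_3 + ('I_s1 + ('I_s2 + 'I_s3)))%type.

(** A single finite index type, axes included, turns the defining polynomial into one indexed
    product to which [leibniz_prod_divides] applies. *)
Definition line (i : line_index) : k * k * k :=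
  match i with
  | inl n => ((n == 0)%:R, (n == 1)%:R, (n == 2)%:R)
  | inr (inl i) => (1, - ct_a A i, 0)
  | inr (inr (inl j)) => (ct_b A j, 0, -1)
  | inr (inr (inr r)) => (0, 1, - ct_c A r)
  end.

Lemma defining_polyE : defining_poly A = \prod_i lform (line i).
Proof.
rewrite /defining_poly /line_forms !big_cat !big_map  -!enumT !big_enum !big_sumType /=.
rewrite !big_ord_recl big_ord0 !big_cons big_nil /=.
congr (_ * _).
  by rewrite /lform /= !scale1r !scale0r !add0r !addr0; congr (_ * (_ * (_ * _))).
congr (_ * (_ * _)); apply: eq_bigr => i _; rewrite /lform /=.
- by rewrite scale1r scaleNr scale0r addr0.
- by rewrite scale0r addr0 scaleN1r.
- by rewrite scale0r add0r scale1r scaleNr.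
Qed.

Lemma line_neq0 i : line i != 0.
Proof.
case: i => [n|[i|[j|r]]]; last 1 first.
all: rewrite -[0]/(0, 0, 0) /= !xpair_eqE ?oner_eq0 ?oppr_eq0 ?oner_eq0 ?andbF //.
by elim/ord3P: n; rewrite /= !oner_eq0 ?andbF.
Qed.

(** Some 2 by 2 minor of the two coefficient triples is nonzero: for lines of different kinds
    because the parameters are nonzero, within one pencil because they are distinct. *)
Lemma line_separated i j : i != j -> elim_lform (line i) (lform (line j)) != 0.
Proof.
move=> ij; apply/eqP => /elim_lform_proportional [].
have a0 := ct_a_neq0 A; have b0 := ct_b_neq0 A; have c0 := ct_c_neq0 A.
move: i j ij => [n|[i|[j|r]]] [m|[i'|[j'|r']]] //=.
all: try (elim/ord3P: n); try (elim/ord3P: m).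
all: rewrite /= ?(mulr0, mul0r, mulr1, mul1r, mulrN, mulNr, oppr0, opprK).
all: move=> // ij e1 e2 e3.
all: try by move/eqP: e1; rewrite ?oppr_eq0 ?oner_eq0 ?(negPf (a0 _)) ?(negPf (b0 _)).
all: try by move/eqP: e2; rewrite ?oppr_eq0 ?oner_eq0 ?(negPf (b0 _)).
all: try by move/eqP: e3; rewrite ?oppr_eq0 ?oner_eq0 ?(negPf (c0 _)).
all: try by move/esym/eqP: e1; rewrite ?oppr_eq0 ?oner_eq0 ?(negPf (a0 _)) ?(negPf (b0 _)).
all: try by move/esym/eqP: e2; rewrite ?oppr_eq0 ?oner_eq0 ?(negPf (b0 _)).
all: try by move/esym/eqP: e3; rewrite ?oppr_eq0 ?oner_eq0 ?(negPf (c0 _)).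
(* Only the pairs within one of the three pencils remain. *)
- by move: e1 ij => /eqP; rewrite eqr_opp (inj_eq (ct_a_inj (c:=A))) => /eqP ->; rewrite eqxx.
- by move: e2 ij => /eqP; rewrite eqr_opp (inj_eq (ct_b_inj (c:=A))) => /eqP ->; rewrite eqxx.
- by move: e3 ij => /eqP; rewrite eqr_opp (inj_eq (ct_c_inj (c:=A))) => /eqP ->; rewrite eqxx.
Qed.

End Lines.

(** * The products [f1], [f2], [f3] and the logarithmic derivations *)

Section Syzygies.

Variables (k : fieldType) (s1 s2 s3 : nat) (A : complete_triangular k s1 s2 s3).
Local Notation R := {mpoly k[3]}.
Local Notation x := ('X_(0 : 'I_3) : R).
Local Notation y := ('X_(1 : 'I_3) : R).
Local Notation z := ('X_(2 : 'I_3) : R).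

Definition form1 i : R := x - ct_a A i *: y.
Definition form2 j : R := ct_b A j *: x - z.
Definition form3 r : R := y - ct_c A r *: z.

(** Both [elim1] and [elim2] eliminate [x], hence fix every [form3 r], as [grid_ideal] requires;
    [elim3] eliminates [y]. *)
Definition elim1 i := subst3 (ct_a A i *: y) y z.
Definition elim2 j := subst3 ((ct_b A j)^-1 *: z) y z.
Definition elim3 r := subst3 x (ct_c A r *: z) z.

Definition f1 := \prod_i form1 i.
Definition f2 := \prod_j form2 j.
Definition f3 := \prod_r form3 r.

Lemma elim1P i : retraction_mod (form1 i) (elim1 i).
Proof.
split=> [|f]; first by rewrite rmorphB !subst3E subrr.
by apply: subst3_congr; rewrite ?subrr; try exact: divides0; apply: divides_refl.
Qed.

Lemma elim2P j : retraction_mod (form2 j) (elim2 j).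
Proof.
have b0 := ct_b_neq0 A j; split=> [|f].
  by rewrite rmorphB !subst3E scalerA mulfV // scale1r subrr.
apply: subst3_congr; rewrite ?subrr; try exact: divides0.
exists (ct_b A j)^-1%:MP; rewrite mul_mpolyC scalerBr scalerA mulVf //.
by rewrite scale1r.
Qed.

Lemma elim3P r : retraction_mod (form3 r) (elim3 r).
Proof.
split=> [|f]; first by rewrite rmorphB !subst3E subrr.
by apply: subst3_congr; rewrite ?subrr; try exact: divides0; apply: divides_refl.
Qed.

Lemma scaleX_neq0 (a : k) i : a != 0 -> a *: ('X_i : R) != 0.
Proof.
move=> a0; apply: contraNneq a0 => /(congr1 (mcoeff U_(i))).
by rewrite mcoeffZ mcoeffXU eqxx mulr1 mcoeff0 => ->.
Qed.

Lemma elim1_form1 i i' : elim1 i (form1 i') = (ct_a A i - ct_a A i') *: y.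
Proof. by rewrite rmorphB !subst3E scalerBl. Qed.

Lemma elim2_form2 j j' : elim2 j (form2 j') = (ct_b A j' / ct_b A j - 1) *: z.
Proof. by rewrite rmorphB !subst3E scalerA scalerBl scale1r. Qed.

Lemma elim3_form3 r r' : elim3 r (form3 r') = (ct_c A r - ct_c A r') *: z.
Proof. by rewrite rmorphB !subst3E scalerBl. Qed.

Lemma a_sub_neq0 i i' : i != i' -> ct_a A i - ct_a A i' != 0.
Proof. by move=> ii; rewrite subr_eq0 (inj_eq (ct_a_inj (c:=A))). Qed.

Lemma b_sub_neq0 j j' : j != j' -> ct_b A j' / ct_b A j - 1 != 0.
Proof.
move=> jj; rewrite subr_eq0 -(inj_eq (mulIf (ct_b_neq0 A j))).
by rewrite divfK ?ct_b_neq0 // mul1r (inj_eq (ct_b_inj (c:=A))) eq_sym.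
Qed.

Lemma c_sub_neq0 r r' : r != r' -> ct_c A r - ct_c A r' != 0.
Proof. by move=> rr; rewrite subr_eq0 (inj_eq (ct_c_inj (c:=A))). Qed.

Lemma f1_divides p : (forall i, elim1 i p = 0) -> divides f1 p.
Proof.
move=> p0; apply: prod_divides (index_enum_uniq _) elim1P _ _ => // i i' ii.
by rewrite elim1_form1 scaleX_neq0 // a_sub_neq0.
Qed.

Lemma f2_divides p : (forall j, elim2 j p = 0) -> divides f2 p.
Proof.
move=> p0; apply: prod_divides (index_enum_uniq _) elim2P _ _ => // j j' jj.
by rewrite elim2_form2 scaleX_neq0 // b_sub_neq0.
Qed.

Lemma f3_divides p : (forall r, elim3 r p = 0) -> divides f3 p.
Proof.
move=> p0; apply: prod_divides (index_enum_uniq _) elim3P _ _ => // r r' rr.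
by rewrite elim3_form3 scaleX_neq0 // c_sub_neq0.
Qed.

Lemma form1E i : form1 i = lform (line A (inr (inl i))).
Proof. by rewrite /lform /= scale1r scaleNr scale0r addr0. Qed.

Lemma form2E j : form2 j = lform (line A (inr (inr (inl j)))).
Proof. by rewrite /lform /= scale0r addr0 scaleN1r. Qed.

Lemma form3E r : form3 r = lform (line A (inr (inr (inr r)))).
Proof. by rewrite /lform /= scale0r add0r scale1r scaleNr. Qed.

Lemma lform_homog (u : k * k * k) : lform u \is 1.-homog.
Proof. by rewrite !rpredD ?rpredZ ?dhomogXi. Qed.

Lemma f1_homog : f1 \is s1.-homog.
Proof.
rewrite -[s1]card_ord; apply: dhomog_prod_linear => i.
by rewrite form1E lform_homog.
Qed.

Lemma f2_homog : f2 \is s2.-homog.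
Proof.
rewrite -[s2]card_ord; apply: dhomog_prod_linear => i.
by rewrite form2E lform_homog.
Qed.

Lemma f3_homog : f3 \is s3.-homog.
Proof.
rewrite -[s3]card_ord; apply: dhomog_prod_linear => i.
by rewrite form3E lform_homog.
Qed.

Lemma lform_line_neq0 i : lform (line A i) != 0.
Proof. by apply: contraNneq (line_neq0 A i) => /lform_eq0 ->. Qed.

Lemma f1_neq0 : f1 != 0.
Proof. by apply/prodf_neq0 => i _; rewrite form1E lform_line_neq0. Qed.

Lemma f2_neq0 : f2 != 0.
Proof. by apply/prodf_neq0 => i _; rewrite form2E lform_line_neq0. Qed.

Lemma f3_neq0 : f3 != 0.
Proof. by apply/prodf_neq0 => i _; rewrite form3E lform_line_neq0. Qed.

(** The lines are pairwise non-proportional primes, so preserving their product amounts to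
    preserving each of them. *)
Lemma Der_log_vfieldP c : Der_log (defining_poly A) (vfield c) <->
  forall i, divides (lform (line A i)) (vfield c (lform (line A i))).
Proof.
rewrite defining_polyE.
rewrite -(leibniz_prod_divides (vfieldM c) (fun i => elim_lformP (line_neq0 A i)));
  last exact: line_separated.
split=> [[_ //]|dv]; split=> //; split; [exact: vfield_linear|exact: vfieldM].
Qed.

Lemma vfield_form1 c i : vfield c (form1 i) = c 0 - ct_a A i *: c 1.
Proof. by rewrite form1E vfield_lform /= scale1r scaleNr scale0r addr0. Qed.

Lemma vfield_form2 c j : vfield c (form2 j) = ct_b A j *: c 0 - c 2.
Proof. by rewrite form2E vfield_lform /= scale0r addr0 scaleN1r. Qed.

Lemma vfield_form3 c r : vfield c (form3 r) = c 1 - ct_c A r *: c 2.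
Proof. by rewrite form3E vfield_lform /= scale0r add0r scale1r scaleNr. Qed.

Lemma lform_axis n : lform (line A (inl n)) = 'X_n.
Proof.
by elim/ord3P: n; rewrite /lform /= scale1r !scale0r ?add0r ?addr0.
Qed.

(* Modulo [x - a y], the image of this form is [x (p 0 - p 1)]. *)
Lemma Der_log_eigenP (p : 'I_3 -> R) :
  Der_log (defining_poly A) (vfield (fun n => p n * 'X_n)) <->
  [/\ divides f1 (p 0 - p 1), divides f2 (p 0 - p 2) & divides f3 (p 1 - p 2)].
Proof.
rewrite Der_log_vfieldP; split=> [dv|[d1 d2 d3]].
  split; [apply: f1_divides => i|apply: f2_divides => j|apply: f3_divides => r].
  - have := dv (inr (inl i)); rewrite -form1E vfield_form1.
    move/(retraction_modP _ (elim1P i))/eqP; rewrite rmorphB subst3Z !rmorphM !subst3x !subst3y.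
    rewrite scalerAr -mulrBl -rmorphB mulf_eq0.
    by rewrite (negPf (scaleX_neq0 _ (ct_a_neq0 A i))) orbF => /eqP.
  - have := dv (inr (inr (inl j))); rewrite -form2E vfield_form2.
    move/(retraction_modP _ (elim2P j))/eqP; rewrite rmorphB subst3Z !rmorphM !subst3x !subst3z.
    rewrite -scalerAr scalerA mulfV ?ct_b_neq0 // scale1r -mulrBl -rmorphB mulf_eq0.
    by rewrite -[X in _ || (X == 0)]scale1r (negPf (scaleX_neq0 _ (oner_neq0 _))) orbF => /eqP.
  - have := dv (inr (inr (inr r))); rewrite -form3E vfield_form3.
    move/(retraction_modP _ (elim3P r))/eqP; rewrite rmorphB subst3Z !rmorphM !subst3y !subst3z.
    rewrite scalerAr -mulrBl -rmorphB mulf_eq0.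
    by rewrite (negPf (scaleX_neq0 _ (ct_c_neq0 A r))) orbF => /eqP.
move=> [n|[i|[j|r]]].
- by rewrite lform_axis vfieldX; apply/divides_mull/divides_refl.
- rewrite -form1E vfield_form1.
  have -> : p 0 * x - ct_a A i *: (p 1 * y) = (p 0 - p 1) * x + p 1 * form1 i.
    by rewrite /form1 -!mul_mpolyC; ring.
  apply: dividesD; last exact/divides_mull/divides_refl.
  apply: divides_mulr; case: d1 => q ->; apply: divides_mull.
  by rewrite /f1 (bigD1 i) //=; apply/divides_mulr/divides_refl.
- rewrite -form2E vfield_form2.
  have -> : ct_b A j *: (p 0 * x) - p 2 * z
    = (p 0 - p 2) * (ct_b A j *: x) + p 2 * form2 j.
    by rewrite /form2 -!mul_mpolyC; ring.
  apply: dividesD; last exact/divides_mull/divides_refl.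
  apply: divides_mulr; case: d2 => q ->; apply: divides_mull.
  by rewrite /f2 (bigD1 j) //=; apply/divides_mulr/divides_refl.
- rewrite -form3E vfield_form3.
  have -> : p 1 * y - ct_c A r *: (p 2 * z) = (p 1 - p 2) * y + p 2 * form3 r.
    by rewrite /form3 -!mul_mpolyC; ring.
  apply: dividesD; last exact/divides_mull/divides_refl.
  apply: divides_mulr; case: d3 => q ->; apply: divides_mull.
  by rewrite /f3 (bigD1 r) //=; apply/divides_mulr/divides_refl.
Qed.

(** The relation is [(p 0 - p 1) + (p 1 - p 2) = p 0 - p 2] for the eigenvalues [p n] of a
    derivation. The differences of degrees are not truncated when [s1], [s2] and [s3] are at most
    [e]. *)
Definition no_syzygy (e : nat) : Prop := forall a b c : R,
  a \is (e - s1).-homog -> b \is (e - s2).-homog -> c \is (e - s3).-homog ->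
  a * f1 + c * f3 = b * f2 -> [/\ a = 0, b = 0 & c = 0].

Lemma Xi_neq0 i : ('X_i : R) != 0.
Proof. by rewrite -[X in X != 0]scale1r scaleX_neq0 ?oner_neq0. Qed.

Lemma euler_multiple_no_syzygy e : (s1 <= e)%N -> (s2 <= e)%N -> (s3 <= e)%N ->
  (forall theta, Der_log_deg (defining_poly A) e.+1 theta -> euler_multiple e theta)
  <-> no_syzygy e.
Proof.
move=> e1 e2 e3; split=> [H a b c ha hb hc syz|H theta].
  (* A multiple of the Euler derivation shifts all [p n] equally, so [p 2] is normalized to 0; the
     differences with it are then [b * f2] and [c * f3], and the syzygy makes [p 0 - p 1] equal to
     [a * f1]. *)
  pose p (n : 'I_3) : R := if n == 0 then b * f2 else if n == 1 then c * f3 else 0.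
  have h0 : p 0 \is e.-homog by rewrite -(subnK e2) dhomogM ?f2_homog.
  have h1 : p 1 \is e.-homog by rewrite -(subnK e3) dhomogM ?f3_homog.
  have [|g _ Hg] := H (vfield (fun n => p n * 'X_n)).
    split; last first.
      exists (fun n => p n * 'X_n); split=> // n; rewrite -(addn1 e).
      apply: dhomogM; last exact: dhomogXi.
      by elim/ord3P: n => //; apply: rpred0.
    apply/Der_log_eigenP; rewrite /p /=; split.
    - by rewrite -syz addrK; apply/divides_mull/divides_refl.
    - by rewrite subr0; apply/divides_mull/divides_refl.
    - by rewrite subr0; apply/divides_mull/divides_refl.
  have pg n : p n = g.
    by have := Hg 'X_n; rewrite /euler !vfieldX => /(mulIf (Xi_neq0 n)).
  have g0 : g = 0 by rewrite -(pg 2).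
  have b0 : b = 0.
    have /eqP := pg 0; rewrite g0 /p /= mulf_eq0 (negPf f2_neq0) orbF.
    by move=> /eqP.
  have c0 : c = 0.
    have /eqP := pg 1; rewrite g0 /p /= mulf_eq0 (negPf f3_neq0) orbF.
    by move=> /eqP.
  split=> //; move/eqP: syz; rewrite b0 c0 !mul0r addr0 mulf_eq0.
  by rewrite (negPf f1_neq0) orbF => /eqP.
move=> [[thetaD thetaf] [c [hc Dtheta]]].
have log : Der_log (defining_poly A) (vfield c).
  by split; [split; [exact: vfield_linear|exact: vfieldM]|rewrite -Dtheta].
(* The axes belong to the arrangement, so each variable divides its coefficient. *)
have dvX n : exists p, c n = p * 'X_n.
  by have /Der_log_vfieldP/(_ (inl n)) := log; rewrite lform_axis vfieldX.
have [p Dc] : exists p : 'I_3 -> R, forall n, c n = p n * 'X_n.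
  have [p0 D0] := dvX 0; have [p1 D1] := dvX 1; have [p2 D2] := dvX 2.
  exists (fun n => if n == 0 then p0 else if n == 1 then p1 else p2) => n.
  by elim/ord3P: n.
have hp n : p n \is e.-homog.
  have := @dhomog_cofactor k (p n) 'X_n e.+1 1 isT (Xi_neq0 n) (dhomogXi k n).
  by rewrite subn1 -Dc; apply.
have [[u Du] [v Dv] [w Dw]] : [/\ divides f1 (p 0 - p 1), divides f2 (p 0 - p 2)
    & divides f3 (p 1 - p 2)].
  apply/Der_log_eigenP; case: log => [_ [g Dg]]; split.
    by split; [exact: vfield_linear|exact: vfieldM].
  by exists g; rewrite -Dg /vfield; apply: eq_bigr => n _; rewrite Dc.
have [||||_ v0 w0] := H u v w.
- by apply: (dhomog_cofactor e1 f1_neq0 f1_homog); rewrite -Du rpredB.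
- by apply: (dhomog_cofactor e2 f2_neq0 f2_homog); rewrite -Dv rpredB.
- by apply: (dhomog_cofactor e3 f3_neq0 f3_homog); rewrite -Dw rpredB.
- by rewrite -Du -Dv -Dw addrA subrK.
have p02 : p 0 = p 2 by apply/eqP; rewrite -subr_eq0 Dv v0 mul0r.
have p12 : p 1 = p 2 by apply/eqP; rewrite -subr_eq0 Dw w0 mul0r.
exists (p 2) => // f; rewrite Dtheta /euler /vfield mulr_sumr.
apply: eq_bigr => n _; rewrite Dc -mulrA; congr (_ * _).
by elim/ord3P: n.
Qed.

End Syzygies.

(** * The kernel of the matrix *)

Section Rank.

Variables (k : fieldType) (s1 s2 s3 : nat) (A : complete_triangular k s1 s2 s3).
Local Notation R := {mpoly k[3]}.
Local Notation x := ('X_(0 : 'I_3) : R).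
Local Notation y := ('X_(1 : 'I_3) : R).
Local Notation z := ('X_(2 : 'I_3) : R).

(* In the range considered, the two cases define the same set. *)
Lemma columnsE e (sl : 'I_e.+1 * 'I_e.+1) :
  (s1 <= s2)%N -> (s2 <= s3)%N -> (s3 <= e)%N -> (e < s1 + s2)%N ->
  (sl \in columns s1 s2 s3 e.+1) =
    [&& (0 < sl.1)%N, (s1 <= sl.1 + sl.2 <= e)%N
      & (sl.1 + s3 <= e)%N || (sl.2 + s2 <= e)%N].
Proof.
case: sl => -[s hs] [l hl] h12 h23 h3 h; rewrite inE /is_column /=.
by case: ifP => c; lia.
Qed.

(** Full column rank is injectivity on column vectors. Indexing these by pairs, and not by ranks in
    an enumeration, lets their entries be read as coefficients of a polynomial. *)
Lemma maximal_rankP d : maximal_rank A d <->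
  forall w : 'I_d * 'I_d -> k,
    (forall i j r, \sum_(sl in columns s1 s2 s3 d)
       ct_c A r ^+ sl.2 * Defs.fsym A sl.1 i j r * w sl = 0) ->
    forall sl, sl \in columns s1 s2 s3 d -> w sl = 0.
Proof.
have sumE (w : 'I_d * 'I_d -> k) u :
    ((\row_v w (enum_val v)) *m (M_mx A d)^T) 0 u =
    \sum_(sl in columns s1 s2 s3 d) ct_c A (enum_val u).2 ^+ sl.2
      * Defs.fsym A sl.1 (enum_val u).1.1 (enum_val u).1.2 (enum_val u).2 * w sl.
  rewrite mxE [RHS]big_enum_val; apply: eq_bigr => v _; rewrite !mxE mulrC.
  by case: (enum_val u) => [[i j] r] /=; case: (enum_val v) => s l.
split=> [rk w Mw sl slc|inj].
  have /row_freeP[N MN] : row_free (M_mx A d)^T by rewrite /row_free mxrank_tr rk.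
  have w0 : \row_v w (enum_val v) = 0 :> 'rV_#|columns s1 s2 s3 d|.
    rewrite -[LHS]mulmx1 -MN mulmxA (_ : _ *m (M_mx A d)^T = 0) ?mul0mx //.
    by apply/rowP => u; rewrite sumE Mw mxE.
  have := congr1 (fun v : 'rV_#|columns s1 s2 s3 d| => v 0 (enum_rank_in slc sl)) w0.
  by rewrite !mxE enum_rankK_in.
rewrite /maximal_rank -mxrank_tr; apply/eqP; apply: inj_row_free => v vM.
(* This extends [v] by zero outside the columns; at most one term of the sum is nonzero. *)
pose w sl := \sum_(n < #|columns s1 s2 s3 d|) (enum_val n == sl)%:R * v 0 n.
have wE n : w (enum_val n) = v 0 n.
  rewrite /w (bigD1 n) //= eqxx mul1r big1 ?addr0 // => m mn.
  by rewrite (inj_eq enum_val_inj) (negPf mn) mul0r.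
have Dv : v = \row_n w (enum_val n) by apply/rowP => n; rewrite mxE wE.
apply/rowP => n; rewrite mxE -wE; apply: inj (enum_valP n) => i j r.
have := congr1 (fun u : 'rV_#|{: 'I_s1 * 'I_s2 * 'I_s3}| => u 0 (enum_rank (i, j, r))) vM.
by rewrite {1}Dv sumE mxE enum_rankK.
Qed.

(* Row (i, j, r) compares the values of [g] at two points of the line
   [y = c_r z]: the ones on [b_j x = z] and on [x = a_i y]. *)
Lemma M_row_evaluation e (g : R) i j r :
  g \is e.-homog ->
  (forall sl, sl \in columns s1 s2 s3 e.+1 -> (sl.1 + sl.2 <= e)%N) ->
  (forall sl : 'I_e.+1 * 'I_e.+1, (0 < sl.1)%N -> (sl.1 + sl.2 <= e)%N ->
     g@_(mon e sl.1 sl.2) != 0 -> sl \in columns s1 s2 s3 e.+1) ->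
  \sum_(sl in columns s1 s2 s3 e.+1)
     ct_c A r ^+ sl.2 * Defs.fsym A sl.1 i j r * g@_(mon e sl.1 sl.2)
  = g.@[pnt (ct_b A j)^-1 (ct_c A r)]
    - g.@[pnt (ct_a A i * ct_c A r) (ct_c A r)].
Proof.
move=> hg cle gc; rewrite !(meval_homog _ _ hg) -sumrB big_mkcond [RHS]big_mkcond.
apply: eq_bigr => -[s l] _ /=; case: ifP => [/cle/= -> |ncol].
  by rewrite /Defs.fsym exprVn; ring.
(* A monomial free of [x] takes the same value at both points, which is why columns with [s = 0] do
   not occur. *)
case: ifP => // sl; have [s0|s_gt0] := posnP s.
  by rewrite /= s0 !expr0 subrr.
have /eqP -> : g@_(mon e s l) == 0.
  by apply: contraFT ncol => /(gc (s, l)); apply.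
by rewrite !mul0r subrr.
Qed.

(** * Values, partial degrees and restrictions of the three products *)

Lemma meval_f1 i c : (f1 A).@[pnt (ct_a A i * c) c] = 0.
Proof.
rewrite rmorph_prod (bigD1 i) //= /form1 mevalB mevalZ !mevalXU.
by rewrite subrr mul0r.
Qed.

Lemma meval_f2 j c : (f2 A).@[pnt (ct_b A j)^-1 c] = 0.
Proof.
rewrite rmorph_prod (bigD1 j) //= /form2 mevalB mevalZ !mevalXU /pnt /=.
by rewrite mulfV ?ct_b_neq0 // subrr mul0r.
Qed.

Lemma meval_f3 r u : (f3 A).@[pnt u (ct_c A r)] = 0.
Proof.
rewrite rmorph_prod (bigD1 r) //= /form3 mevalB mevalZ !mevalXU /pnt /=.
by rewrite mulr1 subrr mul0r.
Qed.

Lemma f1_indep_z : deg_in_le 2 0 (f1 A).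
Proof.
by apply: deg_in_le_prod => i; apply: deg_in_leB;
  [apply: deg_in_leX|apply/deg_in_leZ/deg_in_leX].
Qed.

Lemma f2_indep_y : deg_in_le 1 0 (f2 A).
Proof.
by apply: deg_in_le_prod => j; apply: deg_in_leB;
  [apply/deg_in_leZ/deg_in_leX|apply: deg_in_leX].
Qed.

Lemma f3_indep_x : deg_in_le 0 0 (f3 A).
Proof.
by apply: deg_in_le_prod => r; apply: deg_in_leB;
  [apply: deg_in_leX|apply/deg_in_leZ/deg_in_leX].
Qed.

(** [f2] does not involve [y], so [elim3] fixes it and it stays nonzero modulo every [form3 r]. *)
Lemma f3_divides_f2M b : divides (f3 A) (b * f2 A) -> divides (f3 A) b.
Proof.
move=> [q Dq]; apply: f3_divides => r.
have /eqP : elim3 A r (b * f2 A) = 0.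
  by rewrite Dq rmorphM [f3 A](bigD1 r) //= rmorphM (elim3P A r).1 mul0r mulr0.
rewrite rmorphM mulf_eq0 => /orP[/eqP //|].
suff -> : elim3 A r (f2 A) = f2 A by rewrite (negPf (f2_neq0 A)).
rewrite rmorph_prod; apply: eq_bigr => j _.
by rewrite rmorphB subst3Z subst3x subst3z.
Qed.

(** Eliminating [x = a_i y] and then [y = c_r z] is restriction to the intersection point (a_i c_r :
    c_r : 1). *)
Lemma elim3_elim1 i r p : elim3 A r (elim1 A i p) =
  subst3 ((ct_a A i * ct_c A r) *: z) (ct_c A r *: z) z p.
Proof.
rewrite [LHS](@subst3_ext _ (elim3 A r \o elim1 A i)) => [|a q] /=.
  by rewrite !subst3E scalerA.
by rewrite !subst3Z.
Qed.

Lemma elim3_elim2 j r p : elim3 A r (elim2 A j p) =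
  subst3 ((ct_b A j)^-1 *: z) (ct_c A r *: z) z p.
Proof.
rewrite [LHS](@subst3_ext _ (elim3 A r \o elim2 A j)) => [|a q] /=.
  by rewrite !subst3E.
by rewrite !subst3Z.
Qed.

(** * The two implications between trivial kernel and absence of syzygies *)

Lemma maximal_rank_no_syzygy e :
  (s1 <= s2)%N -> (s2 <= s3)%N -> (s3 <= e)%N -> (e < s1 + s2)%N ->
  maximal_rank A e.+1 -> no_syzygy A e.
Proof.
move=> h12 h23 h3 h12e /maximal_rankP inj a b c ha hb hc syz.
have colE := columnsE _ h12 h23 h3 h12e.
have s1_gt0 : (0 < s1)%N by lia.
pose G := a * f1 A.
have DG : G = b * f2 A - c * f3 A by rewrite -syz addrK.
have hG : G \is e.-homog.
  have := dhomogM ha (f1_homog A); rewrite subnK //; lia.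
(* The two expressions of [G] bound its support differently: [a * f1] bounds the exponent of [z],
   and [b * f2 - c * f3] bounds that of [x] or of [y]. Together they put the monomials divisible by
   [x] among the columns. *)
have G_z : deg_in_le 2 (e - s1) G.
  rewrite -[(e - s1)%N]addn0; apply: deg_in_leM f1_indep_z.
  exact: deg_in_le_homog.
have G_xy m : m \in msupp G -> (m 0%R + s3 <= e)%N || (m 1%R + s2 <= e)%N.
  rewrite DG => /msuppB_le; rewrite mem_cat => /orP[mb|mc]; apply/orP.
    right; have := deg_in_leM (deg_in_le_homog 1 hb) f2_indep_y mb.
    by lia.
  left; have := deg_in_leM (deg_in_le_homog 0 hc) f3_indep_x mc.
  by lia.
have G_col (sl : 'I_e.+1 * 'I_e.+1) : (0 < sl.1)%N -> (sl.1 + sl.2 <= e)%N ->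
    G@_(mon e sl.1 sl.2) != 0 -> sl \in columns s1 s2 s3 e.+1.
  move=> s0 sle; rewrite -mcoeff_msupp => mG; rewrite colE s0 sle andbT /=.
  by have := G_xy _ mG; have := G_z _ mG; rewrite !monE; lia.
have G0 sl : sl \in columns s1 s2 s3 e.+1 -> G@_(mon e sl.1 sl.2) = 0.
  apply: (inj (fun sl => G@_(mon e sl.1 sl.2))) => i j r.
  rewrite M_row_evaluation //; last by move=> sl'; rewrite colE => /and3P[_ /andP[]].
  rewrite {2}/G DG mevalB !mevalM meval_f1 meval_f2 meval_f3.
  by rewrite !mulr0 !subr0.
(* All coefficients at monomials divisible by [x] are column coefficients, hence zero. *)
have G_x : deg_in_le 0 0 G.
  move=> m mG; have dm := dhomog_mf hG mG; rewrite /= mdeg3 in dm.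
  have ms : (m 0%R < e.+1)%N by lia.
  have ml : (m 1%R < e.+1)%N by lia.
  have Dm : mon e (m 0%R) (m 1%R) = m.
    by apply/eqP; rewrite mon_eq ?mdeg3 ?dm ?eqxx //; lia.
  rewrite leqNgt; apply/negP => m0; move: (mG); rewrite mcoeff_msupp => /eqP; apply.
  rewrite -Dm; apply: (G0 (Ordinal ms, Ordinal ml)).
  by apply: G_col; rewrite /= ?Dm -?mcoeff_msupp //; lia.
(* Some [elim1] exists since [s1 > 0]. It kills the multiple [G] of [f1], but also fixes [G], which
   is free of [x]; so [G = 0]. *)
have a0 : a = 0.
  have : elim1 A (Ordinal s1_gt0) G = 0.
    rewrite /G rmorphM [f1 A](bigD1 (Ordinal s1_gt0)) //= rmorphM.
    by rewrite (elim1P A _).1 mul0r mulr0.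
  rewrite [LHS]subst3_indep_x // => /eqP; rewrite mulf_eq0 (negPf (f1_neq0 A)).
  by rewrite orbF => /eqP.
have [q Dq] : divides (f3 A) b.
  by apply: f3_divides_f2M; exists c; rewrite -syz a0 mul0r add0r.
(* The degree of [b] is at most [e - s2], which is less than [s1] and so than [s3]: too small for a
   nonzero multiple of [f3]. *)
have b0 : b = 0.
  rewrite Dq (_ : q = 0) ?mul0r //; apply/mpolyP => m; rewrite mcoeff0.
  apply: (@cofactor_prod_form3_low _ _ (ct_c A) s3) => [||].
  - exact: ct_c_neq0.
  - move=> m' m'2; apply: memN_msupp_eq0; apply/negP => m'b.
    by have := deg_in_le_homog 2 hb; rewrite Dq => /(_ _ m'b); lia.
  - by rewrite card_ord subnn.
split=> //; move/eqP: syz; rewrite a0 b0 !mul0r add0r mulf_eq0.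
by rewrite (negPf (f3_neq0 A)) orbF => /eqP.
Qed.

Lemma no_syzygy_maximal_rank e :
  (s1 <= s2)%N -> (s2 <= s3)%N -> (s3 <= e)%N -> (e < s1 + s2)%N ->
  no_syzygy A e -> maximal_rank A e.+1.
Proof.
move=> h12 h23 h3 h12e nosyz; apply/maximal_rankP => w Mw.
have colE := columnsE _ h12 h23 h3 h12e.
have s1_gt0 : (0 < s1)%N by lia.
have s2_gt0 : (0 < s2)%N by lia.
pose g : R := \sum_(sl in columns s1 s2 s3 e.+1) w sl *: 'X_[mon e sl.1 sl.2].
have cle (sl : 'I_e.+1 * 'I_e.+1) :
    sl \in columns s1 s2 s3 e.+1 -> (sl.1 + sl.2 <= e)%N.
  by rewrite colE => /and3P[_ /andP[]].
have hg : g \is e.-homog.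
  by apply: rpred_sum => sl slc; rewrite rpredZ // mon_homog // cle.
have gE (sl : 'I_e.+1 * 'I_e.+1) : (sl.1 + sl.2 <= e)%N ->
    g@_(mon e sl.1 sl.2) = if sl \in columns s1 s2 s3 e.+1 then w sl else 0.
  move=> sle; rewrite raddf_sum /=.
  transitivity (\sum_(sl' in columns s1 s2 s3 e.+1) if sl' == sl then w sl else 0).
    apply: eq_bigr => sl' slc'; rewrite mcoeffZ mcoeffX mon_eq ?cle //.
    rewrite mdeg3 !monE subnKC // eqxx /= [sl.1 == _ :> nat]eq_sym [sl.2 == _ :> nat]eq_sym.
    rewrite -[_ && _]/(sl' == sl).
    by case: eqVneq => [->|_]; rewrite ?mulr1 ?mulr0.
  rewrite -big_mkcondr /=; case: ifP => slc; last first.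
    by rewrite big1 // => sl' /andP[slc' /eqP Dsl]; rewrite -Dsl slc' in slc.
  by rewrite (big_pred1 sl) // => sl'; rewrite andb_idl // => /eqP ->.
have g_eval i j r : g.@[pnt (ct_b A j)^-1 (ct_c A r)]
    = g.@[pnt (ct_a A i * ct_c A r) (ct_c A r)].
  apply/eqP; rewrite -subr_eq0 -(M_row_evaluation _ _ _ hg cle) => [|sl s0 sle]; last first.
    by rewrite gE //; case: ifP => //; rewrite eqxx.
  apply/eqP; rewrite -[RHS](Mw i j r); apply: eq_bigr => sl slc.
  by rewrite gE ?cle // slc.
(* By [g_eval] the value of [g] depends only on [r], at both kinds of points, so any fixed [j] may
   be used to define the data. *)
have [h [hh h_x h_eval]] := interpolation
  (fun r => g.@[pnt (ct_b A (Ordinal s2_gt0))^-1 (ct_c A r)]) (@ct_c_inj _ _ _ _ A) h3.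
have hG : g - h \is e.-homog by rewrite rpredB.
have elim31 i r : elim3 A r (elim1 A i (g - h)) = 0.
  rewrite elim3_elim1 (subst3_line _ _ hG) mevalB h_eval.
  by rewrite (g_eval i) subrr scale0r.
have elim32 j r : elim3 A r (elim2 A j (g - h)) = 0.
  rewrite elim3_elim2 (subst3_line _ _ hG) mevalB h_eval.
  by rewrite !(g_eval (Ordinal s1_gt0)) subrr scale0r.
have [a [c [ha hc Dac]]] : exists a c, [/\ a \is (e - s1).-homog,
    c \is (e - s3).-homog & g - h = a * f1 A + c * f3 A].
  have [a [c Dac]] : exists a c, g - h = a * f1 A + c * f3 A.
    apply: (grid_ideal (index_enum_uniq _) (index_enum_uniq _) (elim1P A) (elim3P A)).
    - by move=> i r; rewrite rmorphB !subst3E.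
    - move=> i i' r ii; rewrite [X in elim3 A r X]elim1_form1 [elim3 A r _]subst3Z.
      rewrite [X in _ *: X]subst3y scalerA scaleX_neq0 //.
      by rewrite mulf_neq0 ?a_sub_neq0 ?ct_c_neq0.
    - by move=> r r' rr; rewrite elim3_form3 scaleX_neq0 // c_sub_neq0.
    - by move=> i r _ _; apply: elim31.
  (* The cofactors given by [grid_ideal] may be inhomogeneous; since [g - h] is homogeneous, their
     components of the right degree give the same combination. *)
  exists (pihomog mdeg (e - s1) a), (pihomog mdeg (e - s3) c).
  split; rewrite ?pihomogP // -(pihomogMr _ _ (f1_homog A)) -(pihomogMr _ _ (f3_homog A)).
  by rewrite !subnK // ?(leq_trans h12) ?(leq_trans h23) // -pihomogD -Dac pihomog_dE.
have [b [c' [hb hc' Dbc]]] : exists b c', [/\ b \is (e - s2).-homog,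
    c' \is (e - s3).-homog & g - h = b * f2 A + c' * f3 A].
  have [b [c' Dbc]] : exists b c', g - h = b * f2 A + c' * f3 A.
    apply: (grid_ideal (index_enum_uniq _) (index_enum_uniq _) (elim2P A) (elim3P A)).
    - by move=> j r; rewrite rmorphB !subst3E.
    - move=> j j' r jj; rewrite [X in elim3 A r X]elim2_form2 [elim3 A r _]subst3Z.
      rewrite [X in _ *: X]subst3z scaleX_neq0 //.
      exact: b_sub_neq0.
    - by move=> r r' rr; rewrite elim3_form3 scaleX_neq0 // c_sub_neq0.
    - by move=> j r _ _; apply: elim32.
  exists (pihomog mdeg (e - s2) b), (pihomog mdeg (e - s3) c').
  split; rewrite ?pihomogP // -(pihomogMr _ _ (f2_homog A)) -(pihomogMr _ _ (f3_homog A)).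
  by rewrite !subnK // ?(leq_trans h23) // -pihomogD -Dbc pihomog_dE.
(* Subtracting the two expressions of [g - h] produces a syzygy. *)
have [||a0 _ _] := nosyz a b (c - c') ha hb; first by rewrite rpredB.
  by rewrite mulrBl addrA -Dac Dbc addrK.
have {Dac}Dg : g = h + c * f3 A.
  by rewrite -[LHS](subrK h) Dac a0 mul0r add0r addrC.
(* Every column has [s > 0], so [g] vanishes at [x = 0], whereas [h] and [f3] are unchanged there;
   this expresses [h] as a multiple of [f3]. *)
pose s0 := subst3 0 y z.
have s0g : s0 g = 0.
  rewrite rmorph_sum big1 // => sl slc; rewrite [LHS]subst3Z /= comp_mpolyX.
  rewrite (bigD1 0) //= (tnth_nth 0) /= monE expr0n.
  move: slc; rewrite colE => /and3P[]; case: (nat_of_ord sl.1) => // n _ _ _.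
  by rewrite mul0r scaler0.
have {Dg}Dg : g = (c - s0 c) * f3 A.
  have : s0 g = h + s0 c * f3 A.
    rewrite Dg rmorphD rmorphM [s0 h]subst3_indep_x //.
    by rewrite [s0 (f3 A)]subst3_indep_x //; apply: f3_indep_x.
  by rewrite s0g mulrBl => /eqP; rewrite eq_sym addr_eq0 Dg => /eqP ->; rewrite addrC.
(* Columns satisfy [s1 <= s + l], so the exponent of [z] in [g] is at most [e - s1 < s3]. *)
have c0 : c - s0 c = 0.
  apply/mpolyP => m; rewrite mcoeff0.
  apply: (@cofactor_prod_form3_low _ _ (ct_c A) s3) => [||].
  - exact: ct_c_neq0.
  - move=> m' m'2; have [dm|dm] := eqVneq (mdeg m') e; last first.
      by rewrite -[_ * _]Dg (dhomog_nemf_coeff hg).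
    rewrite -[_ * _]Dg; move: dm; rewrite mdeg3 => dm.
    have ms : (m' 0%R < e.+1)%N by lia.
    have ml : (m' 1%R < e.+1)%N by lia.
    have <- : mon e (m' 0%R) (m' 1%R) = m'.
      by apply/eqP; rewrite mon_eq ?mdeg3 ?dm ?eqxx //; lia.
    rewrite (gE (Ordinal ms, Ordinal ml)) /=; last by lia.
    by rewrite colE /=; case: ifP => //; lia.
  - by rewrite card_ord subnn.
by move=> sl slc; have := gE sl (cle sl slc); rewrite slc Dg c0 mul0r mcoeff0.
Qed.

End Rank.

Unset Implicit Arguments.

Theorem theorem4p10 (k : closedFieldType) (hk : [pchar k] =i pred0)
    (s1 s2 s3 : nat) (A : complete_triangular k s1 s2 s3) (d : nat)
    (hs12 : (s1 <= s2)%N) (hs23 : (s2 <= s3)%N) (hs : (s3 + 1 <= s1 + s2)%N)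
    (hd3 : (s3 + 1 <= d)%N) (hd12 : (d <= s1 + s2)%N) :
  (forall theta : {mpoly k[3]} -> {mpoly k[3]},
      Der_log_deg (defining_poly A) d theta -> euler_multiple d.-1 theta)
  <-> maximal_rank A d.
Proof.
(* The eigenvalues of a derivation of degree [d] have degree [e = d - 1], and [s3 + 1 <= d] becomes
   [s3 <= e]. *)
case: d hd3 hd12 => [|e] hd3 hd12; first by rewrite addn1 in hd3.
rewrite addn1 ltnS in hd3; have e2 := leq_trans hs23 hd3.
rewrite [X in X <-> _]euler_multiple_no_syzygy ?(leq_trans hs12) //.
split; first exact: no_syzygy_maximal_rank.
exact: maximal_rank_no_syzygy.
Qed.
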